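(* Let $u,\mathfrak u\in L^2([0,T];\mathbb R^m)$ and let $x_i$, $i\ge1$, be the solutions on $[0,T]$ of $$\dot x_1(t)=Ax_1(t)+Bu(t)+N(\mathfrak u(t)\otimes x_1(t)),\quad x_1(0)=0,$$ $$\dot x_i(t)=Ax_i(t)+N(\mathfrak u(t)\otimes x_i(t))+H\Big(\sum_{k=1}^{i-1}x_k(t)\otimes x_{i-k}(t)\Big),\quad x_i(0)=0,\quad i\ge2.$$ If there is a constant $c$ such that $\sum_{i=1}^\infty\|x_i(t)\|\le c<\infty$ for all $t\in[0,T]$, then $x(t)=\sum_{i=1}^\infty x_i(t)$, $t\in[0,T]$, solves $$\dot x(t)=Ax(t)+Bu(t)+N(\mathfrak u(t)\otimes x(t))+H(x(t)\otimes x(t)),\quad x(0)=0,$$ globally on $[0,T]$.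
   Context: $n,m\in\mathbb N$, $T>0$, $A\in\mathbb R^{n\times n}$, $B\in\mathbb R^{n\times m}$, $N=[N_1\ \dots\ N_m]$, $H=[H_1\ \dots\ H_n]$ with $N_k,H_j\in\mathbb R^{n\times n}$; $\|\cdot\|$ is the Euclidean norm; $\otimes$ is the Kronecker product. Differential equations are understood in integrated form. *)

(* Defs.v *)
From HB Require Import structures.
From mathcomp Require Import all_boot all_order all_algebra.
From mathcomp Require Import all_classical all_reals all_analysis.
From mathcomp Require Export mxtens.
Import Order.TTheory GRing.Theory Num.Theory.
Import numFieldNormedType.Exports.

Set Implicit Arguments.
Unset Strict Implicit.
Unset Printing Implicit Defensive.

Local Open Scope classical_set_scope.
Local Open Scope ring_scope.

Section Defs.
Context {R : realType}.

(* The norm that the library puts on matrices is the sup norm. *)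
Definition enorm n (x : 'cV[R]_n) : R := Num.sqrt (\sum_j x j 0 ^+ 2).

(* [tensmx] returns a matrix with [1 * 1] columns. *)
Definition kron m n (u : 'cV[R]_m) (v : 'cV[R]_n) : 'cV[R]_(m * n) := u *t v.

(* The block row [M_1 ... M_m]; [mxtens_index (k, j)] is column [j] of
   block [k], i.e. column number [k * n + j]. *)
Definition block_row m n (M : 'I_m -> 'M[R]_n) : 'M[R]_(n, m * n) :=
  \matrix_(i, l) M (mxtens_unindex l).1 i (mxtens_unindex l).2.

Lemma block_row_kron m n (M : 'I_m -> 'M[R]_n) (u : 'cV[R]_m) (v : 'cV[R]_n) :
  block_row M *m kron u v = \sum_k u k 0 *: (M k *m v).
Proof.
apply/colP => i; rewrite !mxE summxE.
rewrite (reindex (@mxtens_index m n)) /=; last first.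
  by exists (@mxtens_unindex m n) => l _; rewrite ?mxtens_indexK ?mxtens_unindexK.
pose F k j := block_row M i (mxtens_index (k, j)) *
  kron u v (mxtens_index (k, j)) 0.
rewrite (eq_bigr (fun p => F p.1 p.2)) => [|[]//].
rewrite -(pair_bigA _ F) /=.
apply: eq_bigr => k _; rewrite !mxE mulr_sumr; apply: eq_bigr => j _.
by rewrite /F !mxE !mxtens_indexK /= !ord1 mulrCA.
Qed.

(* Borel representatives of elements of L^2([0,T]; R^m); measurability is
   componentwise since matrices carry no measurable structure. *)
Definition L2 m (T : R) (u : R -> 'cV[R]_m) : Prop :=
  (forall k, measurable_fun `[0, T] (fun t => u t k 0)) /\
  (\int[lebesgue_measure]_(t in `[0%R, T]) (enorm (u t) ^+ 2)%:E < +oo)%E.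

(* Solutions on [0,T] of x' = f(t, x), x(0) = x0, in integrated form:
   x(t) = x0 + \int_0^t f(s, x(s)) ds for t in [0,T].  Integrability has to be
   required since [Rintegral] is total; it makes x absolutely continuous. *)
Definition solves_ivp n (T : R) (f : R -> 'cV[R]_n -> 'cV[R]_n) (x0 : 'cV[R]_n)
    (x : R -> 'cV[R]_n) : Prop :=
  (forall j, lebesgue_measure.-integrable `[0, T]
     (fun s => (f s (x s) j 0)%:E)) /\
  (forall t : R, t \in `[0, T] ->
     x t = x0 + \col_j \int[lebesgue_measure]_(s in `[0, t]) f s (x s) j 0).

End Defs.

(* Main.v *)
Require Import Defs.
From mathcomp Require Import all_boot all_order all_algebra.
From mathcomp Require Import all_classical all_reals all_analysis.
From mathcomp Require Import measurable_realfun lra.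
Import Order.TTheory GRing.Theory Num.Theory.
Import numFieldNormedType.Exports.

Set Implicit Arguments.
Unset Strict Implicit.
Unset Printing Implicit Defensive.

Local Open Scope classical_set_scope.
Local Open Scope ring_scope.

(** The i-th equation is the part of degree i of the full bilinear-quadratic
equation when each [x_ i] is given degree i: its quadratic term collects the
products [x_ k] (x) [x_ (i - k)], which is the i-th coefficient of a Cauchy
product.  Summing the equations over i < k therefore gives, at every time s,
an identity in which the linear terms act on the partial sum S_k(s) and the
quadratic term acts on the k-th partial sum of the Cauchy product of the series
with itself ([sum_graded_rhs]).

The hypothesis bounds the partial sums of every coordinate series absolutely by
c, uniformly in time.  Hence S_k(s) converges to some x(s), the Cauchy product
converges to x(s) (x) x(s) ([cvg_cauchy_product]), and the summed right-hand
sides converge to the right-hand side of the full equation along x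
([sum_graded_rhs_cvg]).  By the same bound they are dominated by a function of
the form C + sum_l C_l |u_l(s)| + sum_l C'_l |v_l(s)| + C''
([sum_graded_rhs_le]), which is integrable because a square-integrable function
on a bounded interval is integrable.

Dominated convergence on [0, t] ([integrable_series_dominated]) lets k tend to
infinity in S_k(t) = sum_(i < k) of the integrals, which is the integrated form
of the limit equation; on [0, T] it gives the integrability of its right-hand
side.

All convergence is handled coordinate by coordinate, which makes the choice of
norm on vectors immaterial. *)

(** * Cauchy products of absolutely bounded real series *)

Section AbsolutelyBoundedSeries.
Context {R : realType}.
Implicit Types a b : nat -> R.

Lemma le_sum_nat_widen (h k : nat) a : (h <= k)%N -> (forall i, 0 <= a i) ->
  \sum_(1 <= i < h) a i <= \sum_(1 <= i < k) a i.
Proof.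
move=> hk a0; case: h hk => [|h] hk.
  by rewrite big_geq//; exact: sumr_ge0.
by rewrite (big_cat_nat _ hk)//= lerDl sumr_ge0.
Qed.

(** Absolute convergence implies convergence; sums start at 1 here, hence the
    shift to the series indexed from 0. *)
Lemma cvgn_abs_bounded_sum a (c : R) :
  (forall k, \sum_(1 <= i < k) `|a i| <= c) ->
  cvgn (fun k => \sum_(1 <= i < k) a i).
Proof.
move=> ac.
have shift b : (fun k => \sum_(1 <= i < k.+1) b i) = series (fun i => b i.+1).
  by apply/funext => k; rewrite big_add1.
suff : cvgn (series (fun i => a i.+1)).
  by rewrite -shift => /cvg_ex[l al]; apply/cvg_ex; exists l; rewrite -cvg_shiftS.
apply: (@normed_cvg R R^o); apply: nondecreasing_is_cvgn.
  by apply: nondecreasing_series => i _ _ /=.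
exists c => _ [k _ <-].
by rewrite /= -(shift (fun i => `|a i|)).
Qed.

(** Both sides run over the pairs l, j >= 1 with l + j < k, by diagonals on the
    left and by rows on the right. *)
Lemma sum_diagonals_triangle (F : nat -> nat -> R) k :
  \sum_(1 <= i < k) \sum_(1 <= l < i) F l (i - l)%N =
  \sum_(1 <= l < k) \sum_(1 <= j < k - l) F l j.
Proof.
elim: k => [|[|k] IH]; [by rewrite !big_geq|by rewrite !big_geq|].
rewrite big_nat_recr//= IH [RHS]big_nat_recr//= subSnn [X in _ = _ + X]big_geq//.
rewrite addr0 -big_split/=; apply: eq_big_nat => l /andP[_ lk].
by rewrite (@subSn _ _ (ltnW lk)) big_nat_recr//= subn_gt0.
Qed.

Lemma sum_diagonals_abs_le a b k :
  \sum_(1 <= i < k) \sum_(1 <= l < i) `|a l| * `|b (i - l)%N| <=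
  (\sum_(1 <= i < k) `|a i|) * \sum_(1 <= i < k) `|b i|.
Proof.
rewrite (sum_diagonals_triangle (fun l j => `|a l| * `|b j|)) mulr_suml.
apply: ler_sum_nat => l _; rewrite -mulr_sumr ler_wpM2l//.
by apply: le_sum_nat_widen; rewrite ?leq_subr.
Qed.

(** The square of side k/2 fits in the triangle l + j < k.  Together with
    [sum_diagonals_abs_le] this traps the sum over the triangle between two
    products of partial sums with the same limit. *)
Lemma le_sum_diagonals_abs a b k :
  (\sum_(1 <= i < k./2) `|a i|) * \sum_(1 <= i < k./2) `|b i| <=
  \sum_(1 <= i < k) \sum_(1 <= l < i) `|a l| * `|b (i - l)%N|.
Proof.
rewrite (sum_diagonals_triangle (fun l j => `|a l| * `|b j|)) mulr_suml.
have kk : (k./2 + k./2 <= k)%N by rewrite addnn -[leqRHS]odd_double_half leq_addl.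
apply: (@le_trans _ _
    (\sum_(1 <= l < k./2) \sum_(1 <= j < k - l) `|a l| * `|b j|)); last first.
  apply: (@le_sum_nat_widen _ _ (fun l => \sum_(1 <= j < k - l) `|a l| * `|b j|)).
    exact: leq_trans (leq_addr _ _) kk.
  by move=> l; apply: sumr_ge0 => j _; rewrite mulr_ge0.
apply: ler_sum_nat => l /andP[_ lk]; rewrite -mulr_sumr ler_wpM2l//.
apply: le_sum_nat_widen => //.
by rewrite leq_subRL (leq_trans _ kk)//; [rewrite leq_add2r ltnW|
  rewrite (leq_trans (ltnW lk))// leq_addr].
Qed.

(** Both differences are sums over the same corner l, j < k <= l + j of the
    square, so the triangle inequality applies term by term. *)
Lemma dist_sum_diagonals_le a b k :
  `|(\sum_(1 <= i < k) a i) * (\sum_(1 <= i < k) b i) -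
    \sum_(1 <= i < k) \sum_(1 <= l < i) a l * b (i - l)%N| <=
  (\sum_(1 <= i < k) `|a i|) * (\sum_(1 <= i < k) `|b i|) -
  \sum_(1 <= i < k) \sum_(1 <= l < i) `|a l| * `|b (i - l)%N|.
Proof.
have corner (F : nat -> nat -> R) :
    \sum_(1 <= l < k) \sum_(1 <= j < k) F l j -
    \sum_(1 <= i < k) \sum_(1 <= l < i) F l (i - l)%N =
    \sum_(1 <= l < k) \sum_(k - l <= j < k) F l j.
  rewrite sum_diagonals_triangle -sumrB; apply: eq_big_nat => l /andP[l0 lk].
  rewrite (@big_cat_nat _ _ _ (k - l) 1 k)//= ?subn_gt0 ?leq_subr//.
  by rewrite addrAC subrr add0r.
have prodE a' b' : (\sum_(1 <= i < k) a' i) * (\sum_(1 <= i < k) b' i) =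
    \sum_(1 <= l < k) \sum_(1 <= j < k) a' l * b' j :> R.
  by rewrite mulr_suml; apply: eq_bigr => l _; rewrite mulr_sumr.
rewrite !prodE (corner (fun l j => a l * b j)).
rewrite (corner (fun l j => `|a l| * `|b j|)).
apply: le_trans (ler_norm_sum _ _ _) _; apply: ler_sum => l _.
apply: le_trans (ler_norm_sum _ _ _) _; apply: ler_sum => j _.
by rewrite normrM.
Qed.

(** With P k the product of the k-th partial sums of absolute values, the corner
    l, j < k <= l + j contributes at most P k - P (k/2), which vanishes because
    P converges. *)
Lemma cvg_cauchy_product a b (c c' sa sb : R) :
  (forall k, \sum_(1 <= i < k) `|a i| <= c) ->
  (forall k, \sum_(1 <= i < k) `|b i| <= c') ->
  \sum_(1 <= i < k) a i @[k --> \oo] --> sa ->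
  \sum_(1 <= i < k) b i @[k --> \oo] --> sb ->
  \sum_(1 <= i < k) \sum_(1 <= l < i) a l * b (i - l)%N @[k --> \oo] --> sa * sb.
Proof.
move=> ac bc asa bsb.
pose P k := (\sum_(1 <= i < k) `|a i|) * (\sum_(1 <= i < k) `|b i|).
have Pcvg : cvgn P.
  apply: is_cvgM; apply: cvgn_abs_bounded_sum => k;
    under eq_bigr do rewrite normr_id; [exact: ac|exact: bc].
have half_oo : k./2 @[k --> \oo] --> \oo.
  apply/cvgnyPge => A; near=> k.
  rewrite -[leqLHS]doubleK; apply: half_leq; near: k; exact: nbhs_infty_ge.
have P0 : P k - P k./2 @[k --> \oo] --> 0.
  rewrite -(subrr (limn P)); apply: cvgB => //.
  exact: (cvg_comp _ _ half_oo Pcvg).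
rewrite -[sa * sb]subr0.
pose prod k := (\sum_(1 <= i < k) a i) * (\sum_(1 <= i < k) b i).
pose diag k := \sum_(1 <= i < k) \sum_(1 <= l < i) a l * b (i - l)%N.
rewrite [X in X @ \oo --> _](_ : _ = fun k => prod k - (prod k - diag k)); last first.
  by apply/funext => k; rewrite subKr.
apply: cvgB; first exact: cvgM.
apply/norm_cvg0P; apply: squeeze_cvgr (cvg_cst 0) P0.
near=> k; rewrite normr_ge0/=; apply: le_trans (dist_sum_diagonals_le a b k) _.
by rewrite lerB// le_sum_diagonals_abs.
Unshelve. all: by end_near.
Qed.

End AbsolutelyBoundedSeries.

(** * Term-by-term integration *)

Lemma integrable_series_dominated d (X : measurableType d) (R : realType)
    (mu : {measure set X -> \bar R}) (D : set X) (f_ : nat -> X -> R)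
    (f g : X -> R) : measurable D ->
  (forall i, (0 < i)%N -> mu.-integrable D (EFin \o f_ i)) ->
  mu.-integrable D (EFin \o g) ->
  (forall s, D s -> \sum_(1 <= i < k) f_ i s @[k --> \oo] --> f s) ->
  (forall s k, D s -> `|\sum_(1 <= i < k) f_ i s| <= g s) ->
  mu.-integrable D (EFin \o f) /\
  \sum_(1 <= i < k) \int[mu]_(s in D) f_ i s @[k --> \oo] -->
    \int[mu]_(s in D) f s.
Proof.
move=> mD if_ ig cvf gf.
pose S k s := \sum_(1 <= i < k) f_ i s.
have iS k : mu.-integrable D (EFin \o S k) /\
    \int[mu]_(s in D) S k s = \sum_(1 <= i < k) \int[mu]_(s in D) f_ i s.
  elim: k => [|[|k] [IH IH']].
  - split; last by rewrite /S big_geq//; under eq_Rintegral do rewrite big_geq//;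
      rewrite /Rintegral integral0.
    by apply: eq_integrable (integrable0 _ _) => // s _; rewrite /S /= big_geq.
  - split; last by rewrite /S big_geq//; under eq_Rintegral do rewrite big_geq//;
      rewrite /Rintegral integral0.
    by apply: eq_integrable (integrable0 _ _) => // s _; rewrite /S /= big_geq.
  have SS : S k.+2 = fun s => S k.+1 s + f_ k.+1 s.
    by apply/funext => s; rewrite /S big_nat_recr.
  rewrite SS; split; first by have := integrableD mD IH (if_ k.+1 isT).
  by rewrite big_nat_recr//= -IH' RintegralD//; exact: if_.
have mS k : measurable_fun D (EFin \o S k) by exact: (measurable_int _ (iS k).1).
have cvS s : D s -> (EFin \o S k) s @[k --> \oo] --> (EFin \o f) s.
  by move=> Ds; apply: cvg_EFin; [exact: nearW|exact: cvf].
have mf : measurable_fun D (EFin \o f) by exact: emeasurable_fun_cvg mS cvS.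
have [||if' _ lim] := dominated_convergence mD mS mf _ ig.
- exact: aeW.
- by apply: aeW => s k Ds; rewrite /= lee_fin; exact: gf.
split=> //; under eq_fun do rewrite -(iS _).2.
by apply: fine_cvg; rewrite /Rintegral fineK ?integrable_fin_num.
Qed.

(** * Coordinates of vectors and integrability of the inputs *)

Section Vectors.
Context {R : realType}.

Lemma le_enorm_coord n (x : 'cV[R]_n) j : `|x j 0| <= enorm x.
Proof.
rewrite -sqrtr_sqr ler_wsqrtr// (bigD1 j)//= lerDl.
by apply: sumr_ge0 => i _; exact: sqr_ge0.
Qed.

Lemma kronE m n (x : 'cV[R]_m) (y : 'cV[R]_n) l :
  kron x y l 0 = x (mxtens_unindex l).1 0 * y (mxtens_unindex l).2 0.
Proof. by rewrite mxE !ord1. Qed.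

Lemma cvg_colP n (x : nat -> 'cV[R]_n) (y : 'cV[R]_n) :
  x k @[k --> \oo] --> y <-> forall j, x k j 0 @[k --> \oo] --> y j 0.
Proof.
split=> [xy j|xy].
  exact: (cvg_comp _ (fun z : 'cV[R]_n => z j 0) xy (@coord_continuous _ _ _ _ _ y)).
apply/cvg_ballP => e e0; near=> k; split=> // i j; rewrite ord1 {j}.
move: i; near: k; apply: filter_forall => i.
by move: e e0; apply/cvg_ballP; exact: xy.
Unshelve. all: by end_near.
Qed.

Lemma cvg_mulmx_coord p q (M : 'M[R]_(p, q)) (x : nat -> 'cV[R]_q)
    (y : 'cV[R]_q) :
  (forall l, x k l 0 @[k --> \oo] --> y l 0) ->
  forall j, (M *m x k) j 0 @[k --> \oo] --> (M *m y) j 0.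
Proof.
move=> xy j; rewrite mxE; under eq_fun do rewrite mxE.
apply: cvg_big => [|l _]; first exact: add_continuous.
by apply: cvgM; [exact: cvg_cst|exact: xy].
Qed.

Lemma mulmx_coord_le p q (M : 'M[R]_(p, q)) (x : 'cV[R]_q) (w : 'I_q -> R) j :
  (forall l, `|x l 0| <= w l) -> `|(M *m x) j 0| <= \sum_l `|M j l| * w l.
Proof.
move=> xw; rewrite mxE; apply: le_trans (ler_norm_sum _ _ _) _.
by apply: ler_sum => l _; rewrite normrM ler_wpM2l.
Qed.

Lemma integrable_sumZ d (X : measurableType d) (mu : {measure set X -> \bar R})
    (D : set X) q (a : 'I_q -> R) (f : 'I_q -> X -> R) : measurable D ->
  (forall l, mu.-integrable D (EFin \o f l)) ->
  mu.-integrable D (EFin \o (fun s => \sum_l a l * f l s)).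
Proof.
move=> mD fi.
rewrite (_ : EFin \o _ = fun s => (\sum_l (a l)%:E * (f l s)%:E)%E).
  by apply: integrable_sum => // l _; exact: (integrableZl mD (a l) (fi l)).
by apply/funext => s /=; rewrite -sumEFin.
Qed.

Lemma integrable_cst_itv (T c : R) :
  lebesgue_measure.-integrable `[0, T] (EFin \o (fun=> c)).
Proof.
apply: continuous_compact_integrable; first exact: segment_compact.
by apply: continuous_subspaceT => x; exact: cvg_cst.
Qed.

(** On a bounded interval L^2 is contained in L^1: |u_l| <= 1 + |u|^2. *)
Lemma L2_coord_integrable m (T : R) (u : R -> 'cV[R]_m) l : L2 T u ->
  lebesgue_measure.-integrable `[0, T] (EFin \o (fun s => `|u s l 0|)).
Proof.
move=> [mu u2].
have enorm2 s : enorm (u s) ^+ 2 = \sum_j u s j 0 ^+ 2.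
  by rewrite sqr_sqrtr// sumr_ge0// => j _; exact: sqr_ge0.
have i2 : lebesgue_measure.-integrable `[0, T] (EFin \o (fun s => enorm (u s) ^+ 2)).
  apply/integrableP; split; last first.
    by under eq_integral do rewrite /= ger0_norm ?sqr_ge0//.
  apply/measurable_EFinP; rewrite (funext enorm2).
  by apply: measurable_sum => j; exact: (measurable_funX 2 (mu j)).
have := integrableD _ (integrable_cst_itv T 1) i2; move=> /(_ (measurable_itv _)).
apply: le_integrable => //.
- by apply/measurable_EFinP; apply: measurableT_comp => //; exact: mu.
- move=> s _; rewrite /= lee_fin normr_id [leRHS]ger0_norm ?addr_ge0 ?sqr_ge0//.
  have le_u := le_enorm_coord (u s) l; apply: le_trans le_u _.
  set e := enorm _; have := sqr_ge0 (e - 1); have := sqr_ge0 e.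
  rewrite sqrrB1; lra.
Qed.

End Vectors.

(** * Summing the graded equations *)

Section SeriesAtFixedTime.
Context {R : realType} (n m : nat).
Variables (A : 'M[R]_n) (N : 'M[R]_(n, m * n)) (H : 'M[R]_(n, n * n)).
Variables (b : 'cV[R]_n) (v : 'cV[R]_m).

(** One formula for all equations of the hierarchy: the source b enters in degree 1
    only, and the quadratic sum is empty there. *)
Definition graded_rhs (y : nat -> 'cV[R]_n) (i : nat) : 'cV[R]_n :=
  A *m y i + (i == 1)%:R *: b + N *m kron v (y i) +
  H *m \sum_(1 <= k < i) kron (y k) (y (i - k)%N).

Variables (y : nat -> 'cV[R]_n) (c : R).
Hypothesis yc : forall j k, \sum_(1 <= i < k) `|y i j 0| <= c.

Let S k := \sum_(1 <= i < k) y i.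
Let diagonals k := \sum_(1 <= i < k) \sum_(1 <= l < i) kron (y l) (y (i - l)%N).

Lemma bounded_series_coord_cvg j :
  S k j 0 @[k --> \oo] --> limn S j 0.
Proof.
have coord_cvg l : cvgn (fun k => S k l 0).
  under eq_fun do rewrite summxE.
  exact: cvgn_abs_bounded_sum (yc l).
suff /cvg_colP : S @ \oo --> limn S by apply.
apply/cvg_ex; exists (\col_l limn (fun k => S k l 0)).
by apply/cvg_colP => l; rewrite mxE; exact: coord_cvg.
Qed.

Lemma bounded_series_is_cvg : cvgn S.
Proof.
by apply/cvg_ex; exists (limn S); apply/cvg_colP => j; exact: bounded_series_coord_cvg.
Qed.

(** The factor (1 < k) is there because the partial sums for k = 0 and k = 1 are
    empty and do not yet contain the source b. *)
Lemma sum_graded_rhs k :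
  \sum_(1 <= i < k) graded_rhs y i =
  A *m S k + (1 < k)%:R *: b + N *m kron v (S k) + H *m diagonals k.
Proof.
rewrite /graded_rhs !big_split/=; congr (_ + _ + _ + _).
- by rewrite mulmx_sumr.
- rewrite -scaler_suml; congr (_ *: _).
  case: k => [|[|k]]; [by rewrite big_geq|by rewrite big_geq|].
  by rewrite big_ltn//= big_nat_cond big1 ?addr0// => -[|[|i]].
- rewrite -mulmx_sumr; congr (_ *m _); apply/colP => l.
  rewrite kronE !summxE mulr_sumr; apply: eq_bigr => i _; exact: kronE.
- by rewrite mulmx_sumr.
Qed.

Let diagonals_coord k l : diagonals k l 0 = \sum_(1 <= i < k) \sum_(1 <= h < i)
  y h (mxtens_unindex l).1 0 * y (i - h)%N (mxtens_unindex l).2 0.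
Proof.
rewrite summxE; apply: eq_bigr => i _; rewrite summxE.
by apply: eq_bigr => h _; exact: kronE.
Qed.

Lemma sum_graded_rhs_cvg j :
  (\sum_(1 <= i < k) graded_rhs y i) j 0 @[k --> \oo] -->
  (A *m limn S + b + N *m kron v (limn S) + H *m kron (limn S) (limn S)) j 0.
Proof.
under eq_fun do rewrite sum_graded_rhs 3!mxE.
rewrite 3!mxE; apply: cvgD; [apply: cvgD; [apply: cvgD|]|].
- by apply: cvg_mulmx_coord; exact: bounded_series_coord_cvg.
- apply: cvg_near_cst; near=> k; rewrite (_ : (1 < k)%N) ?scale1r//.
  by near: k; exact: nbhs_infty_gt.
- apply: cvg_mulmx_coord => l; rewrite kronE; under eq_fun do rewrite kronE.
  by apply: cvgM; [exact: cvg_cst|exact: bounded_series_coord_cvg].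
- apply: cvg_mulmx_coord => l; rewrite kronE; under eq_fun do rewrite diagonals_coord.
  apply: (cvg_cauchy_product (yc _) (yc _)).
    by have := @bounded_series_coord_cvg (mxtens_unindex l).1; under eq_fun do rewrite summxE.
  by have := @bounded_series_coord_cvg (mxtens_unindex l).2; under eq_fun do rewrite summxE.
Unshelve. all: by end_near.
Qed.

(** The bound does not depend on k, and involves the trajectories only through c; with b
    and v taken at time s it is a dominating function of s. *)
Lemma sum_graded_rhs_le j k :
  `|(\sum_(1 <= i < k) graded_rhs y i) j 0| <=
  \sum_l `|A j l| * c + `|b j 0| +
  \sum_l `|N j l| * c * `|v (mxtens_unindex l).1 0| +
  \sum_l `|H j l| * (c * c).
Proof.
have Sc l : `|S k l 0| <= c.
  by rewrite summxE; apply: le_trans (ler_norm_sum _ _ _) (yc l k).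
have c0 : 0 <= c by have := yc j 0; rewrite big_geq.
rewrite sum_graded_rhs 3!mxE.
apply: le_trans (ler_normD _ _) (lerD _ _); last first.
- apply: mulmx_coord_le => l; rewrite diagonals_coord.
  apply: le_trans (ler_norm_sum _ _ _) _.
  apply: (@le_trans _ _ (\sum_(1 <= i < k) \sum_(1 <= h < i)
      `|y h (mxtens_unindex l).1 0| * `|y (i - h)%N (mxtens_unindex l).2 0|)).
    apply: ler_sum => i _; apply: le_trans (ler_norm_sum _ _ _) _.
    by apply: ler_sum => h _; rewrite normrM.
  apply: le_trans (@sum_diagonals_abs_le _ (fun i => y i (mxtens_unindex l).1 0)
    (fun i => y i (mxtens_unindex l).2 0) k) _.
  by rewrite ler_pM// sumr_ge0.
apply: le_trans (ler_normD _ _) (lerD _ _); last first.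
- under eq_bigr do rewrite -mulrA.
  by apply: mulmx_coord_le => l; rewrite kronE normrM mulrC ler_wpM2r.
apply: le_trans (ler_normD _ _) (lerD _ _); last first.
- rewrite mxE normrM; case: (1 < k)%N; rewrite ?normr1 ?mul1r//.
  by rewrite normr0 mul0r.
exact: mulmx_coord_le.
Qed.

End SeriesAtFixedTime.

(** * Convergence to a solution *)

(** Being a solution depends on the vector field along the trajectory only; this
    makes [graded_rhs], which takes the whole sequence of states, a legitimate
    right-hand side of each single equation. *)
Lemma solves_ivp_ext (R : realType) n (T : R) (f g : R -> 'cV[R]_n -> 'cV[R]_n)
    (x0 : 'cV[R]_n) (x : R -> 'cV[R]_n) : (forall t, f t (x t) = g t (x t)) ->
  solves_ivp T f x0 x -> solves_ivp T g x0 x.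
Proof.
move=> fg; have E j : (fun t => f t (x t) j 0) = (fun t => g t (x t) j 0).
  by apply/funext => t; rewrite fg.
move=> [fi xE]; split=> [j|t tT].
  by apply: eq_integrable (fi j) => // t _; rewrite fg.
by rewrite xE//; congr (_ + _); apply/colP => j; rewrite !mxE E.
Qed.

Theorem proposition2p1 (R : realType) (n m : nat) (T : R) (hT : 0 < T)
    (A : 'M[R]_n) (B : 'M[R]_(n, m))
    (N_ : 'I_m -> 'M[R]_n) (H_ : 'I_n -> 'M[R]_n)
    (u v : R -> 'cV[R]_m) (hu : L2 T u) (hv : L2 T v)
    (x_ : nat -> R -> 'cV[R]_n)
    (hx1 : solves_ivp T
       (fun t z => A *m z + B *m u t + block_row N_ *m kron (v t) z)
       0 (x_ 1%N))
    (hxi : forall i : nat, (2 <= i)%N ->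
       solves_ivp T
         (fun t z => A *m z + block_row N_ *m kron (v t) z
            + block_row H_ *m
                (\sum_(1 <= k < i) kron (x_ k t) (x_ (i - k)%N t)))
         0 (x_ i))
    (c : R)
    (hc : forall t : R, t \in `[0, T] ->
       (\sum_(1 <= i <oo) (enorm (x_ i t))%:E <= c%:E)%E) :
  (forall t : R, t \in `[0, T] -> cvgn (fun k => \sum_(1 <= i < k) x_ i t)) /\
  solves_ivp T
    (fun t z => A *m z + B *m u t + block_row N_ *m kron (v t) z
       + block_row H_ *m kron z z)
    0 (fun t => limn (fun k => \sum_(1 <= i < k) x_ i t)).
Proof.
have yc t : t \in `[0, T] -> forall j k, \sum_(1 <= i < k) `|x_ i t j 0| <= c.
  move=> tT j k; rewrite -lee_fin; apply: le_trans (hc t tT).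
  rewrite -sumEFin; apply: (@le_trans _ _ (\sum_(1 <= i < k) (enorm (x_ i t))%:E)%E).
    by apply: lee_sum => i _; rewrite lee_fin le_enorm_coord.
  by apply: nneseries_lim_ge => i _ _; rewrite lee_fin sqrtr_ge0.
split=> [t tT|]; first exact: bounded_series_is_cvg (yc t tT).
pose rhs i t := graded_rhs A (block_row N_) (block_row H_) (B *m u t) (v t)
  (x_^~ t) i.
have sol i : (0 < i)%N -> solves_ivp T (fun t _ => rhs i t) 0 (x_ i).
  case: i => [//|[|i]] _.
    apply: solves_ivp_ext hx1 => t; rewrite /rhs /graded_rhs eqxx scale1r.
    by rewrite [\sum_(1 <= k < 1) _]big_geq// mulmx0 addr0.
  apply: solves_ivp_ext (hxi i.+2 isT) => t.
  by rewrite /rhs /graded_rhs scale0r addr0.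
pose g j t := \sum_l `|A j l| * c + \sum_l `|B j l| * `|u t l 0| +
  \sum_l `|block_row N_ j l| * c * `|v t (mxtens_unindex l).1 0| +
  \sum_l `|block_row H_ j l| * (c * c).
have mI (a : R) : measurable (`[0, a] : set (measurableTypeR R)).
  exact: measurable_itv.
have ig j : lebesgue_measure.-integrable `[0, T] (EFin \o g j).
  have iv (l : 'I_(m * n)) : lebesgue_measure.-integrable `[0, T]
    (EFin \o (fun t => `|v t (mxtens_unindex l).1 0|)) by exact: L2_coord_integrable hv.
  have iu l : lebesgue_measure.-integrable `[0, T]
    (EFin \o (fun t => `|u t l 0|)) by exact: L2_coord_integrable hu.
  have i1 := integrableD (mI T) (integrable_cst_itv T (\sum_l `|A j l| * c))
    (integrable_sumZ (fun l => `|B j l|) (mI T) iu).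
  have i2 := integrableD (mI T) i1
    (integrable_sumZ (fun l => `|block_row N_ j l| * c) (mI T) iv).
  exact: (integrableD (mI T) i2 (integrable_cst_itv T _)).
pose x t := limn (fun k => \sum_(1 <= i < k) x_ i t).
pose f t := A *m x t + B *m u t + block_row N_ *m kron (v t) (x t) +
  block_row H_ *m kron (x t) (x t).
(* The cases of use are t = T, for integrability, and an arbitrary t, for the
   limit of the integrated equations. *)
have key j t : t \in `[0, T] ->
    lebesgue_measure.-integrable `[0, t] (EFin \o (fun s => f s j 0)) /\
    \sum_(1 <= i < k) \int[lebesgue_measure]_(s in `[0, t]) rhs i s j 0
      @[k --> \oo] --> \int[lebesgue_measure]_(s in `[0, t]) f s j 0.
  move=> tT.
  have sub : (`[0, t] : set R) `<=` `[0, T].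
    move=> s /=; rewrite !in_itv/= => /andP[-> st].
    by move: tT; rewrite in_itv/= => /andP[_]; exact: le_trans.
  apply: (@integrable_series_dominated _ _ _ (@lebesgue_measure R) _
    (fun i s => rhs i s j 0) (fun s => f s j 0) (g j)).
  - exact: mI.
  - move=> i /sol[irhs _]; exact: (integrableS (mI T) (mI t) sub (irhs j)).
  - exact: (integrableS (mI T) (mI t) sub (ig j)).
  - move=> s /sub sT; have := sum_graded_rhs_cvg (A := A) (N := block_row N_)
      (H := block_row H_) (b := B *m u s) (v := v s) (yc _ sT) (j := j).
    by under eq_fun do rewrite summxE.
  - move=> s k /sub sT; rewrite -summxE.
    apply: le_trans (sum_graded_rhs_le _ _ _ _ _ (yc _ sT) j k) _.
    by rewrite !lerD2r lerD2l mulmx_coord_le.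
split=> [j|t tT].
  by apply: (key j T _).1; rewrite in_itv/= lexx ltW.
apply/colP => j; rewrite !mxE add0r.
have := @bounded_series_coord_cvg _ _ _ _ (yc _ tT) j.
have -> : (fun k => (\sum_(1 <= i < k) x_ i t) j 0) = fun k =>
    \sum_(1 <= i < k) \int[lebesgue_measure]_(s in `[0, t]) rhs i s j 0.
  apply/funext => k; rewrite summxE; apply: eq_big_nat => i /andP[i0 _].
  by rewrite (sol i i0).2// !mxE add0r.
move=> xlim; by apply: cvg_unique xlim (key j t tT).2.
Qed.
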